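(* Let $A \subset \mathbb{Z}^\omega$ be an analytic set that is not Haar-null in the Polish group $\mathbb{Z}^\omega$. Then there exists a closed set $C \subset \mathbb{Z}^\omega$ with $C \subset A$ such that $C$ is not Haar-null.
   Context: $\mathbb{Z}^\omega$ is the Polish group given by the $\omega$'th power of the (discrete) additive group of the integers, with the product topology and coordinatewise addition. A set $S$ in a Polish group $(G,\cdot)$ is called Haar-null if there exist a universally measurable set $U \supset S$ (that is, a set measurable with respect to every Borel probability measure on $G$) and a Borel probability measure $\mu$ on $G$ such that $\mu(gUh)=0$ for every $g,h\in G$. For $G=\mathbb{Z}^\omega$, which is abelian and written additively, the last condition says $\mu(U+g)=0$ for every $g \in \mathbb{Z}^\omega$. *)

(* Defs.v *)
From HB Require Import structures.
From mathcomp Require Import all_boot all_order all_algebra.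
From mathcomp Require Import all_classical all_reals all_analysis.
From mathcomp Require Import measurable_realfun.

Set Implicit Arguments.
Unset Strict Implicit.
Unset Printing Implicit Defensive.

Import Order.TTheory GRing.Theory Num.Theory.

Local Open Scope classical_set_scope.
Local Open Scope ring_scope.

Definition Zomega : Type := {ptws nat -> discrete_topology int}.

HB.instance Definition _ := Topological.on Zomega.
HB.instance Definition _ := GRing.Zmodule.copy Zomega (nat -> int).

Lemma Zomega_cvgP (F : set_system Zomega) (x : Zomega) : Filter F ->
  (forall i, F [set y : Zomega | y i = x i]) -> F --> x.
Proof.
move=> FF Fx; apply/cvg_sup => i.
apply/cvg_image; first by rewrite eqEsubset; split=> // v _; exists (fun=> v).
move=> B /nbhs_singleton Bxi; exists [set y : Zomega | B (y i)].
  by apply: filterS (Fx i) => y /= ->.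
by rewrite eqEsubset; split=> [_ [y By <-]//|v Bv]; exists (fun=> v).
Qed.

Lemma Zomega_nbhs (x : Zomega) (i : nat) :
  nbhs x [set y : Zomega | y i = x i].
Proof.
exact: (@proj_continuous nat (fun=> discrete_topology int) i x _
  (discrete_set1 _)).
Qed.

Lemma Zomega_sub_continuous :
  continuous (fun x : Zomega * Zomega => x.1 - x.2).
Proof.
move=> [x y].
have FF : Filter ((fun x : Zomega * Zomega => x.1 - x.2) @ nbhs (x, y)).
  exact: fmap_filter.
apply: (@Zomega_cvgP _ (x - y) FF).
move=> i.
exists ([set z : Zomega | z i = x i], [set z : Zomega | z i = y i]).
  by split; exact: Zomega_nbhs.
by move=> [z t] /= [zx ty]; congr (_ - _).
Qed.

HB.instance Definition _ :=
  PreTopologicalNmodule_isTopologicalZmodule.Build Zomega Zomega_sub_continuous.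

(* The measurable types of the library have to be pointed, which a topological
   abelian group is not canonically. *)
Definition pointed0 (G : topologicalZmodType) : Type := G.

HB.instance Definition _ (G : topologicalZmodType) :=
  Choice.on (pointed0 G).
HB.instance Definition _ (G : topologicalZmodType) :=
  isPointed.Build (pointed0 G) (0 : G).

Definition borel (G : topologicalZmodType) : Type :=
  @g_sigma_algebraType (pointed0 G) (@open G).

HB.instance Definition _ (G : topologicalZmodType) := Measurable.on (borel G).

Section HaarNull.
Context (R : realType) (G : topologicalZmodType).

Definition universally_measurable (U : set G) : Prop :=
  forall mu : probability (borel G) R, completed_algebra_gen mu U.

(* [mu.-negligible] says that the completion of [mu] vanishes on its argument:
   a translate of a universally measurable set need not be Borel. *)
Definition haar_null (S : set G) : Prop :=
  exists U : set G, [/\ universally_measurable U, S `<=` U &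
    exists mu : probability (borel G) R,
      forall g : G, mu.-negligible [set u + g | u in U]].

End HaarNull.

(* Continuous images of the Baire space, and the empty set. *)
Definition analytic_set (T : topologicalType) (A : set T) : Prop :=
  A = set0 \/
  exists2 f : {ptws nat -> nat} -> T, continuous f & range f = A.

(* Main.v *)
Require Import Defs.
From mathcomp Require Import all_boot all_order all_algebra.
From mathcomp Require Import all_classical all_reals all_analysis.
From HB Require Import structures.
From mathcomp Require Import measurable_realfun zify ring lra.

(** Write the analytic set as A = range phi, with phi continuous on the Baire
space.  Three facts carry the proof.

Test measures.  For a sequence of side lengths f, let mu_f be the uniform
probability on the box of all u with 0 <= u i < f i.  If f grows much faster
than h, translating the box by a vector with coordinates bounded by h changes
only a small proportion of it, in all coordinates at once.  So if a set meets
some translate of the box in positive proportion, averaging over the translates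
shows that it has a translate of positive measure for every probability carried
by vectors bounded by h ([avg_shift], [average_measure]).  By tightness
([tight_cylinder]), a set is not Haar null as soon as it does so for
arbitrarily fast f; conversely, as A is not Haar null, it meets a translate of
every mu_f, and by inner regularity ([inner_regular]) already the compact set of
the phi y with y bounded by some b does.  A triple (f, g, b) of side lengths,
translation and bound is called a witness below; that it captures a growth rate
c in proportion at least 2^-n ([captures]) is a closed condition on c and the
witness, and a condition inherited by smaller c.  A diagonal argument makes n
independent of c ([captures_total]).

Uniformization.  A closed relation between c and w that is total, and inherited
by smaller c, is uniformized by a continuous function ([uniformization]): if no
finite part of c ever determined the next value of w, the counterexamples,
which are countably many, could all be dominated by one sequence from some
point on.  Hence witnesses Phi c depending continuously on c.

Properness.  The compact sets attached to all the Phi c need not have a closed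
union, since c ranges over a space that is not compact.  Keep from the compact
set of Phi c only the x with c i <= |x i| for all i ([spread_image]).  Since c i
is much smaller than the side length f i, this costs a small proportion of the
box ([sum_near_le]).  When points x of the pieces converge, the c of these
pieces are now bounded in each coordinate, so a subsequence of them converges as
well, and the limit of the x lies in the piece of the limit
([spread_image_closed]). *)

Set Implicit Arguments.
Unset Strict Implicit.
Unset Printing Implicit Defensive.

Import Order.TTheory GRing.Theory Num.Theory.

Local Open Scope classical_set_scope.
Local Open Scope ring_scope.

(** * Initial segments of sequences *)

Section Sequences.
Context {V : Type}.
Implicit Types (x y z : nat -> V).

Definition agree (N : nat) x y := forall i, (i < N)%N -> x i = y i.

Definition upd x (k : nat) (v : V) : nat -> V :=
  fun i => if i == k then v else x i.

Lemma agree_sym N x y : agree N x y -> agree N y x.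
Proof. by move=> xy i iN; rewrite xy. Qed.

Lemma agree_trans N x y z : agree N x y -> agree N y z -> agree N x z.
Proof. by move=> xy yz i iN; rewrite xy // yz. Qed.

Lemma agree_le M N x y : (M <= N)%N -> agree N x y -> agree M x y.
Proof. by move=> MN xy i iM; apply: xy; apply: leq_trans MN. Qed.

Lemma agree_upd k x v : agree k x (upd x k v).
Proof. by move=> i ik; rewrite /upd (ltn_eqF ik). Qed.

Lemma updE x k v : upd x k v k = v.
Proof. by rewrite /upd eqxx. Qed.

Lemma agree_updS k x y : agree k x y -> agree k.+1 (upd x k (y k)) y.
Proof.
move=> xy i; rewrite ltnS leq_eqVlt /upd => /predU1P[->|ik]; first by rewrite eqxx.
by rewrite (ltn_eqF ik) xy.
Qed.

End Sequences.

(** Compactness of the product of the intervals [0, B i].  Only [P N] of an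
initial segment is ever tested, so the usual tree argument applies: keep a
finite sequence that extends to a point of [P N] for every N; one of the
finitely many next values keeps this property. *)
Lemma konig (B : nat -> nat) (P : nat -> (nat -> nat) -> Prop) :
  (forall N y z, agree N y z -> P N y -> P N z) ->
  (forall N y, P N.+1 y -> P N y) ->
  (forall N, exists2 y, (forall i, (y i <= B i)%N) & P N y) ->
  exists2 y, (forall i, (y i <= B i)%N) & forall N, P N y.
Proof.
move=> Pagree PS Pex.
have Pmono M N y : (M <= N)%N -> P N y -> P M y.
  move=> /subnK <-; elim: (N - M)%N => [//|n IH] /PS; exact: IH.
pose extendable k y := forall N, exists z,
  [/\ forall i, (z i <= B i)%N, agree k y z & P N z].
have step k y : extendable k y ->
    exists v, (v <= B k)%N /\ extendable k.+1 (upd y k v).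
  move=> ext; apply: contrapT => no.
  have /choice[n nP] : forall v, exists N, (v <= B k)%N -> ~ exists z,
      [/\ forall i, (z i <= B i)%N, agree k.+1 (upd y k v) z & P N z].
    move=> v; apply: contrapT => /forallNP h; apply: no; exists v; split.
      by apply: contrapT => vB; apply: (h 0%N).
    by move=> N; apply: contrapT => nz; apply: (h N).
  have [z [zB yz Pz]] := ext (\max_(v < (B k).+1) n v).
  apply: (nP (z k) (zB k)); exists z; split=> //; first exact: agree_updS.
  apply: Pmono Pz; have zk : (z k < (B k).+1)%N by rewrite ltnS.
  exact: (@leq_bigmax _ (fun v : 'I_(B k).+1 => n v) (Ordinal zk)).
have /choice[f fP] : forall p : nat * (nat -> nat), exists v,
    extendable p.1 p.2 -> (v <= B p.1)%N /\ extendable p.1.+1 (upd p.2 p.1 v).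
  move=> [k y] /=; have [e|ne] := pselect (extendable k y); last by exists 0%N.
  by have [v hv] := step _ _ e; exists v.
pose s := fix s k := if k is k'.+1 then upd (s k') k' (f (k', s k'))
                     else (fun=> 0%N).
have sext k : extendable k (s k).
  elim: k => [|k IH]; last by have [] := fP (k, s k) IH.
  by move=> N; have [z zB Pz] := Pex N; exists z.
have sagree k : agree k (fun i => s i.+1 i) (s k).
  elim: k => [//|k IH] i; rewrite ltnS leq_eqVlt => /predU1P[->//|ik].
  by rewrite IH //= /upd (ltn_eqF ik).
exists (fun i => s i.+1 i).
  by move=> i /=; rewrite updE; have [] := fP (i, s i) (sext i).
move=> N; have [z [_ sz Pz]] := sext N N.
by apply: Pagree Pz; apply: agree_sym; apply: agree_trans sz.
Qed.

(** * Continuous uniformization of monotone closed relations *)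

Section Uniformization.
Context {V : countType} (v0 : V) (R : (nat -> nat) -> (nat -> V) -> Prop).
Hypothesis R_closed : forall c w,
  (forall N, exists c' w', [/\ agree N c c', agree N w w' & R c' w']) -> R c w.
Hypothesis R_antitone : forall c c' w,
  (forall i, (c' i <= c i)%N) -> R c w -> R c' w.
Hypothesis R_total : forall c, exists w, R c w.

(** The first [p] values of [c] already allow the segment of [t] of length [k] to
be kept as an initial segment of an answer, however [c] goes on. *)
Let decided (p : nat) (c : nat -> nat) (k : nat) (t : nat -> V) :=
  forall h, agree p c h -> exists2 w, agree k t w & R h w.

Let decided_agree p c c' k t : agree p c c' ->
  decided p c k t -> decided p c' k t.
Proof. by move=> cc' dec h c'h; apply: dec; apply: agree_trans c'h. Qed.

(** The next value of the answer is decided after finitely many further values of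
[c].  Otherwise, for each stage [q] and each value [v], some [bad] continuation
of the first [q] values of [c] has no answer going on with [v].  Dominate [bad]
of [q] and [v] from the index [maxn p (pickle v)] on, for all pairs at once; the
answer to the dominating sequence has some next value [v], and by monotonicity
it also answers the corresponding [bad] sequence.  Answering late is what makes
this work: the index from which domination holds depends on [v]. *)
Let decided_step p c k t : decided p c k t ->
  exists q v, (p <= q)%N /\ decided q c k.+1 (upd t k v).
Proof.
move=> dec; apply: contrapT => no.
have /choice[bad badP] : forall qv : nat * V, exists h, (p <= qv.1)%N ->
    agree qv.1 c h /\
    forall w, agree k.+1 (upd t k qv.2) w -> ~ R h w.
  move=> [q v]; apply: contrapT => /forallNP nh; apply: no; exists q, v.
  have pq : (p <= q)%N by apply: contrapT => npq; apply: (nh c).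
  split=> // h ch; apply: contrapT => nw; apply: (nh h) => _; split=> // w tw Rw.
  by apply: nw; exists w.
pose b q m n := bad (q, odflt v0 (unpickle m)) n.
pose h n := if (n < p)%N then c n else
  maxn (c n) (\max_(q < n.+1) \max_(m < n.+1) b q m n).
have hc n : (c n <= h n)%N by rewrite /h; case: ifP => // _; rewrite leq_maxl.
have [|w tw Rw] := dec h; first by move=> i ip; rewrite /h ip.
pose v := w k; pose q := maxn p (pickle v).
have pq : (p <= q)%N by rewrite leq_maxl.
have [/= ch nR] := badP (q, v) pq.
apply: (nR w); first exact: (@agree_updS _ k t w).
apply: R_antitone Rw => n; have [nq|qn] := ltnP n q; first by rewrite -ch.
have vn : (pickle v <= n)%N by apply: leq_trans qn; rewrite leq_maxr.
rewrite /h ltnNge (leq_trans pq qn) /= leq_max; apply/orP; right.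
rewrite -ltnS in qn; rewrite -ltnS in vn.
apply: leq_trans (@leq_bigmax _ (fun q : 'I_n.+1 => \max_(m < n.+1) b q m n) (Ordinal qn)).
apply: leq_trans (@leq_bigmax _ (fun m : 'I_n.+1 => b q m n) (Ordinal vn)).
by rewrite /= /b pickleK.
Qed.

(** Least stage at which a next value is decided.  Minimality makes the set of
moves a function of the values of [c] read so far, hence the choice made in it
continuous in [c]. *)
Let moves p k t (c : nat -> nat) : set (nat * V) :=
  [set qv | [/\ (p <= qv.1)%N, decided qv.1 c k.+1 (upd t k qv.2) &
    forall q v, (p <= q)%N -> decided q c k.+1 (upd t k v) -> (qv.1 <= q)%N]].

Let moves_ex p c k t : decided p c k t -> exists qv, moves p k t c qv.
Proof.
move=> /decided_step [q0 [v1 [pq0 d0]]].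
pose Q q := `[< (p <= q)%N /\ exists v, decided q c k.+1 (upd t k v) >].
have exQ : exists q, Q q by exists q0; apply/asboolP; split=> //; exists v1.
case: (ex_minnP exQ) => q /asboolP[pq [v dv]] qmin; exists (q, v); split=> //.
by move=> q' v' pq' dv'; apply: qmin; apply/asboolP; split=> //; exists v'.
Qed.

Let moves_local p k t c c' qv : agree qv.1 c c' ->
  moves p k t c qv -> moves p k t c' = moves p k t c.
Proof.
have sub c1 c2 : agree qv.1 c1 c2 -> moves p k t c1 qv ->
    moves p k t c2 qv.
  move=> cc' [pq dq qmin]; split=> //; first exact: decided_agree dq.
  move=> q v pq1 d; rewrite leqNgt; apply/negP => qq.
  suff : (qv.1 <= q)%N by rewrite leqNgt qq.
  apply: (qmin _ v) => //; apply: decided_agree d.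
  by apply: agree_sym; apply: agree_le cc'; apply: ltnW.
have sub2 c1 c2 : agree qv.1 c1 c2 -> moves p k t c1 qv ->
    moves p k t c1 `<=` moves p k t c2.
  move=> cc' mqv [q v] mq; have /= eq_q : q = qv.1.
    case: mqv mq => ? ? min1 [? ? min2]; apply/eqP; rewrite eqn_leq.
    by rewrite (min1 _ v) // (min2 _ qv.2).
  case: mq => pq dq _; rewrite /= in pq dq; split=> /=; rewrite //.
    by apply: decided_agree dq; rewrite eq_q.
  by have [_ _] := sub _ _ cc' mqv; rewrite eq_q.
move=> cc' mqv; rewrite eqEsubset; split; last exact: sub2.
by apply: sub2; [exact: agree_sym|exact: sub mqv].
Qed.

Let state c := fix state k : nat * (nat -> V) :=
  if k is k'.+1 then
    let qv := xget (0%N, v0) (moves (state k').1 k' (state k').2 c) in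
    (qv.1, upd (state k').2 k' qv.2)
  else (0%N, fun=> v0).

Let state_decided c k : decided (state c k).1 c k (state c k).2.
Proof.
elim: k => [h _|k IH]; first by have [w Rw] := R_total h; exists w.
by have /(xgetPex (0%N, v0))[] := moves_ex IH.
Qed.

Let state_le c k : ((state c k).1 <= (state c k.+1).1)%N.
Proof. by have /(xgetPex (0%N, v0))[] := moves_ex (@state_decided c k). Qed.

Let state_local c c' k : agree (state c k).1 c c' -> state c' k = state c k.
Proof.
elim: k => [//|k IH] cc'; have mv := xgetPex (0%N, v0) (moves_ex (@state_decided c k)).
rewrite /= IH; last by apply: agree_le cc'; exact: state_le.
by rewrite (moves_local cc').
Qed.

(** The decided values, put together, answer [c] because the relation is closed. *)
Lemma uniformization : exists Phi : (nat -> nat) -> nat -> V,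
  (forall c, R c (Phi c)) /\
  forall c N, exists M, forall c', agree M c c' -> agree N (Phi c) (Phi c').
Proof.
have le c k l : (k <= l)%N -> ((state c k).1 <= (state c l).1)%N.
  move=> /subnK <-; elim: (l - k)%N => [//|n IH].
  by apply: leq_trans IH _; exact: state_le.
have agr c k : agree k (fun i => (state c i.+1).2 i) (state c k).2.
  elim: k => [//|k IH] i; rewrite ltnS leq_eqVlt => /predU1P[->//|ik].
  by rewrite IH //= /upd (ltn_eqF ik).
exists (fun c i => (state c i.+1).2 i); split=> [c|c N].
  apply: R_closed => N.
  (* a sequence with the values of c up to the stage at which N values of the
     answer are decided *)
  have [|w tw Rw] := @state_decided c N (fun i => if (i < maxn N (state c N).1)%N then c i else 0%N).
    by move=> i iN; rewrite leq_max iN orbT.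
  eexists; exists w; split; last exact: Rw.
    by move=> i iN; rewrite leq_max iN.
  by apply: agree_trans tw; exact: agr.
exists (state c N).1 => c' cc' i iN.
by rewrite (@state_local c c') //; apply: agree_le cc'; exact: le.
Qed.

End Uniformization.

(** * Cylinders and Borel sets of the sequence spaces *)

Lemma nbhs_ptws (T : topologicalType) (x : {ptws nat -> T})
    (S : set {ptws nat -> T}) :
  nbhs x S -> exists N, forall y : {ptws nat -> T}, agree N x y -> S y.
Proof.
pose F : set_system {ptws nat -> T} :=
  [set S | exists N, forall y : {ptws nat -> T}, agree N x y -> S y].
have FF : Filter F.
  split; first by exists 0%N.
    move=> P Q [M MP] [N NQ]; exists (maxn M N) => y xy; split.
      by apply: MP; apply: agree_le xy; rewrite leq_maxl.
    by apply: NQ; apply: agree_le xy; rewrite leq_maxr.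
  by move=> P Q PQ [M MP]; exists M => y /MP /PQ.
suff /(_ S) : F --> x by [].
apply/cvg_sup => i.
apply/cvg_image; first by rewrite eqEsubset; split=> // v _; exists (fun=> v).
move=> B /nbhs_singleton Bxi.
exists [set y : {ptws nat -> T} | B (y i)].
  by exists i.+1 => y xy /=; rewrite -xy.
by rewrite eqEsubset; split=> [_ [y By <-]//|v Bv]; exists (fun=> v).
Qed.

Lemma nbhs_Zomega (x : Zomega) (S : set Zomega) :
  nbhs x S <-> exists N, forall y : Zomega, agree N x y -> S y.
Proof.
split; first exact: (@nbhs_ptws (discrete_topology int)).
move=> [N NS]; suff : nbhs x [set y : Zomega | agree N x y] by apply: filterS.
elim: N {NS} => [|N IH]; first by apply: filterS filterT.
apply: filterS (filterI IH (Zomega_nbhs x N)) => y /= [xy yN] i.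
by rewrite ltnS leq_eqVlt => /predU1P[->//|/xy].
Qed.

Lemma Zomega_addE (u v : Zomega) i : (u + v) i = (u i + v i :> int)%R.
Proof. by []. Qed.

Lemma Zomega_subE (u v : Zomega) i : (u - v) i = (u i - v i :> int)%R.
Proof. by []. Qed.

Definition cylindrical (N : nat) (S : set Zomega) : Prop :=
  forall x y : Zomega, agree N x y -> S x -> S y.

Lemma cylindrical_open N (S : set Zomega) : cylindrical N S -> open S.
Proof.
move=> SN; rewrite openE => x Sx; apply/nbhs_Zomega.
by exists N => y xy; apply: SN Sx.
Qed.

Lemma closed_agree (S : set Zomega) :
  (forall x : Zomega, (forall N, exists2 y : Zomega, agree N x y & S y) -> S x) ->
  closed S.
Proof.
move=> Scl x clx; apply: Scl => N.
have [|y [Sy xy]] := clx [set y : Zomega | agree N x y]; last by exists y.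
by apply/nbhs_Zomega; exists N.
Qed.

Lemma continuous_agree (phi : {ptws nat -> nat} -> Zomega) (N : nat)
    (y : {ptws nat -> nat}) : continuous phi ->
  exists M, forall y', agree M y y' -> agree N (phi y) (phi y').
Proof.
move=> /(_ y) cphi; apply: (@nbhs_ptws nat y [set y' | agree N (phi y) (phi y')]).
by apply: cphi; apply/nbhs_Zomega; exists N.
Qed.

Lemma open_borel (S : set Zomega) : open S -> measurable (S : set (borel Zomega)).
Proof. by move=> oS; apply: sub_sigma_algebra. Qed.

Lemma closed_borel (S : set Zomega) : closed S -> measurable (S : set (borel Zomega)).
Proof.
move=> cS; rewrite -[S]setCK; apply: measurableC; apply: open_borel.
exact: closed_openC.
Qed.

Lemma cylindrical_borel N (S : set Zomega) : cylindrical N S -> measurable (S : set (borel Zomega)).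
Proof. by move=> /cylindrical_open; exact: open_borel. Qed.

(** * Thick sets and inner regularity of analytic sets *)

Section Thick.
Context {d : measure_display} {T : measurableType d} {R : realType}.
Variable mu : probability T R.
Local Open Scope ereal_scope.

Lemma nonincreasing_measure_ge (F : (set T)^nat) (r : R) :
  (forall n, measurable (F n)) -> (forall n, F n.+1 `<=` F n) ->
  (forall n, r%:E <= mu (F n)) -> r%:E <= mu (\bigcap_n F n).
Proof.
move=> mF nF rF; have mcap : measurable (\bigcap_n F n) by exact: bigcapT_measurable.
have niF : nonincreasing_seq F.
  by apply/nonincreasing_seqP => n; apply/subsetPset; exact: nF.
have F0 : mu (F 0%N) < +oo by rewrite ltey_eq fin_num_measure.
have cF := nonincreasing_cvg_mu F0 mF mcap niF.
rewrite -(cvg_lim _ cF)//; apply: lime_ge; first by apply/cvg_ex; eexists; exact: cF.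
by apply: nearW => n; exact: rF.
Qed.

Lemma nondecreasing_measure_le (F : (set T)^nat) (r : R) :
  (forall n, measurable (F n)) -> (forall n, F n `<=` F n.+1) ->
  (forall n, mu (F n) <= r%:E) -> mu (\bigcup_n F n) <= r%:E.
Proof.
move=> mF nF rF; have mcup : measurable (\bigcup_n F n) by exact: bigcupT_measurable.
have ndF : nondecreasing_seq F.
  by apply/nondecreasing_seqP => n; apply/subsetPset; exact: nF.
have cF := nondecreasing_cvg_mu (mu := mu) mF mcup ndF.
rewrite -(cvg_lim _ cF)//; apply: lime_le; first by apply/cvg_ex; eexists; exact: cF.
by apply: nearW => n; exact: rF.
Qed.

(** Outer measure larger than [r], for sets that may fail to be measurable. *)
Definition thick (r : R) (S : set T) :=
  forall B, measurable B -> S `<=` B -> r%:E < mu B.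

(** Continuity from below of the outer measure.  If every [S n] had a measurable
cover [B n] of measure at most [r], the tail intersections of the [B n] would
increase to a cover of the union, still of measure at most [r]. *)
Lemma thick_bigcup (r : R) (S : (set T)^nat) :
  (forall n, S n `<=` S n.+1) -> thick r (\bigcup_n S n) ->
  exists n, thick r (S n).
Proof.
move=> nS thS; apply: contrapT => /forallNP no.
have /choice[B BP] : forall n, exists B, [/\ measurable B, S n `<=` B & mu B <= r%:E].
  move=> n; apply: contrapT => /forallNP nB; apply: (no n) => B mB SB.
  by rewrite ltNge; apply/negP => Br; apply: (nB B).
pose C n := \bigcap_(l in [set l | (n <= l)%N]) B l.
have mC n : measurable (C n).
  apply: bigcap_measurable => [|l _]; first by exists n; exact: leqnn.
  by have [mB _ _] := BP l.
have nC n : C n `<=` C n.+1 by move=> x Cx l /= nl; apply: Cx => /=; exact: ltnW.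
have Smono m n : (m <= n)%N -> S m `<=` S n.
  by move=> /subnK <-; elim: (n - m)%N => [//|k IH] x /IH; exact: nS.
suff : mu (\bigcup_n C n) <= r%:E.
  rewrite leNgt => /negP; apply; apply: thS; first exact: bigcupT_measurable.
  move=> x [n _ Sx]; exists n => // l /= nl.
  by have [_ SB _] := BP l; apply: SB; apply: Smono Sx.
apply: nondecreasing_measure_le => // n; have [mB _ Br] := BP n.
by apply: le_trans Br; apply: le_measure; rewrite ?inE // => x Cx; exact: Cx (leqnn n).
Qed.

Lemma thick_not_negligible (S : set T) : ~ mu.-negligible S ->
  exists2 r : R, (0 < r)%R & thick r S.
Proof.
move=> nnS; apply: contrapT => no.
have /choice[B BP] : forall n, exists B, [/\ measurable B, S `<=` B &
    (mu B <= (n.+1%:R^-1)%:E)%E].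
  move=> n; apply: contrapT => /forallNP nB; apply: no.
  exists (n.+1%:R^-1)%R => // B mB SB; rewrite ltNge; apply/negP => Bn.
  by apply: (nB B).
have mB n : measurable (B n) by have [] := BP n.
apply: nnS; exists (\bigcap_n B n); split.
- exact: bigcapT_measurable.
- apply/eqP; rewrite eq_le measure_ge0 andbT; apply/lee_addgt0Pr => e e0.
  rewrite add0e; have [n _ /(_ n (leqnn _))] := near_infty_natSinv_lt (PosNum e0).
  move=> /= /ltW ne; have [_ _ Bn] := BP n; apply: le_trans (le_trans Bn _).
    by apply: le_measure; rewrite ?inE //; [exact: bigcapT_measurable|move=> x; exact].
  by rewrite lee_fin.
- by move=> x Sx n _; have [_ SB _] := BP n; exact: SB.
Qed.

End Thick.

Section CompactImages.
Variable phi : {ptws nat -> nat} -> Zomega.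
Hypothesis phi_cont : continuous phi.

Definition image_below (b : nat -> nat) (m : nat) : set Zomega :=
  phi @` [set y | forall j, (j < m)%N -> (y j <= b j)%N].

(** The points of Z^omega that the first [m] coordinates do not separate from
[image_below b m]; its intersection over [m] is the image of the compact set of
the sequences bounded by [b]. *)
Definition approx_image (b : nat -> nat) (m : nat) : set Zomega :=
  [set x | exists2 z, image_below b m z & agree m x z].

Definition compact_image (b : nat -> nat) : set Zomega :=
  \bigcap_m approx_image b m.

Lemma approx_image_cylindrical b m : cylindrical m (approx_image b m).
Proof.
by move=> x y xy [z Sz xz]; exists z => //; apply: agree_trans xz; exact: agree_sym.
Qed.

Lemma approx_imageS b m : approx_image b m.+1 `<=` approx_image b m.
Proof.
move=> x [_ [y yb <-] xz]; exists (phi y); last by apply: agree_le xz.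
by exists y => // j jm; apply: yb; exact: leqW.
Qed.

Lemma approx_image_agree b b' m : agree m b b' ->
  approx_image b m `<=` approx_image b' m.
Proof.
move=> bb' x [_ [y yb <-] xz]; exists (phi y) => //; exists y => // j jm /=.
by rewrite -bb' // yb.
Qed.

(** Each approximation provides a preimage bounded by [b] on a longer and longer
segment; compactness gives one that serves all of them, and continuity of [phi]
identifies its image. *)
Lemma compact_image_sub b : compact_image b `<=` range phi.
Proof.
move=> x Kx.
pose P N (y : nat -> nat) := exists y' : {ptws nat -> nat},
  [/\ forall j, (j < N)%N -> (y' j <= b j)%N, agree N y y' & agree N x (phi y')].
have [|||y _ yP] := @konig b P.
- by move=> N y z yz [y' [y'b yy' xy']]; exists y'; split=> //;
    apply: agree_trans yy'; exact: agree_sym.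
- move=> N y [y' [y'b yy' xy']]; exists y'; split=> [j jN||].
  + by apply: y'b; exact: leqW.
  + exact: agree_le yy'.
  + exact: agree_le xy'.
- move=> N; have [_ [y yb <-] xz] := Kx N I.
  exists (fun j => if (j < N)%N then y j else 0%N).
    by move=> j; case: ifP => // /yb.
  by exists y; split=> // j jN; rewrite jN.
exists y => //; apply/funext => i.
have [M cM] := continuous_agree i.+1 y phi_cont.
have [y' [_ yy' xy']] := yP (maxn M i.+1).
rewrite (cM y') //; last by apply: agree_le yy'; rewrite leq_maxl.
by rewrite xy' // leq_maxr.
Qed.

Lemma compact_image_closed b : closed (compact_image b).
Proof.
apply: closed_agree => x xcl m _; have [y xy Ky] := xcl m.
by apply: approx_image_cylindrical (Ky m I); exact: agree_sym.
Qed.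

(** Choquet's capacity argument.  Bounding the first coordinates of the argument
of [phi] one by one, [thick_bigcup] provides each time a bound large enough to
keep the image thick.  The approximations are clopen cylinders, so that
their measures pass to the limit. *)
Lemma inner_regular (R : realType) (mu : probability (borel Zomega) R) (r : R) :
  thick mu r (range phi) -> exists b, (r%:E <= mu (compact_image b))%E.
Proof.
move=> thr.
have /choice[f fP] : forall p : nat * (nat -> nat), exists v,
    thick mu r (image_below p.2 p.1) ->
    thick mu r (image_below (upd p.2 p.1 v) p.1.+1).
  move=> [m b] /=; have [th|] := pselect (thick mu r (image_below b m)); last first.
    by exists 0%N.
  pose S v : set (borel Zomega) := image_below (upd b m v) m.+1.
  have [|/=|v thv] := @thick_bigcup _ _ _ mu r S; last by exists v.
    move=> v _ [y yb <-]; exists y => // j jm; apply: leq_trans (yb j jm) _.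
    by rewrite /upd; case: eqP => // _; exact: leqnSn.
  move=> B mB SB; apply: th => // _ [y yb <-]; apply: SB; exists (y m) => //.
  exists y => // j; rewrite /= ltnS leq_eqVlt /upd => /predU1P[->|jm].
    by rewrite eqxx.
  by rewrite (ltn_eqF jm) yb.
pose s := fix s k := if k is k'.+1 then upd (s k') k' (f (k', s k'))
                     else (fun=> 0%N).
have sth k : thick mu r (image_below (s k) k).
  elim: k => [|k IH]; last exact: (fP (k, s k)).
  by move=> B mB SB; apply: thr => // _ [y _ <-]; apply: SB; exists y.
have sagree k : agree k (s k) (fun i => s i.+1 i).
  elim: k => [//|k IH] i; rewrite ltnS leq_eqVlt => /predU1P[->//|ik].
  by rewrite -IH //= /upd (ltn_eqF ik).
exists (fun i => s i.+1 i); apply: nonincreasing_measure_ge => m.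
- exact: cylindrical_borel (@approx_image_cylindrical _ m).
- exact: approx_imageS.
apply/ltW/(sth m); first exact: cylindrical_borel (@approx_image_cylindrical _ m).
by move=> x Sx; apply: approx_image_agree (sagree m) _ _; exists x.
Qed.

(** With [s] the outer measure of the range, compact subsets of measure at least
[s - 1/(n+1)] exhaust the range up to a set that lies in measurable sets of
measure at most [2/(n+1)]. *)
Lemma range_universally_measurable (R : realType) :
  universally_measurable R (range phi).
Proof.
move=> mu; set A := range phi.
pose D := [set r : R | thick mu r A].
have supD : has_sup D.
  split.
    exists (-1)%R => B mB _; apply: (@lt_le_trans _ _ 0%E); last exact: measure_ge0.
    by rewrite lte_fin ltrN10.
  exists 1%R => r /(_ setT measurableT (fun _ _ => I)).
  by rewrite probability_setT lte_fin => /ltW.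
have /choice[b bP] : forall n, exists b, ((sup D - n.+1%:R^-1)%:E <= mu (compact_image b))%E.
  move=> n; have [|r Dr rs] := sup_adherent _ supD (eps := n.+1%:R^-1); first by [].
  have [b rb] := inner_regular Dr; exists b; apply: le_trans rb.
  by rewrite lee_fin ltW.
have /choice[B BP] : forall n, exists B : set (borel Zomega),
    [/\ measurable B, A `<=` B & (mu B <= (sup D + n.+1%:R^-1)%:E)%E].
  move=> n; apply: contrapT => /forallNP nB.
  have /(sup_upper_bound supD) : D (sup D + n.+1%:R^-1).
    by move=> B mB AB; rewrite ltNge; apply/negP => le; apply: (nB B).
  by rewrite gerDl leNgt invr_gt0 ltr0Sn.
have mK n : measurable (compact_image (b n) : set (borel Zomega)).
  by apply: closed_borel; exact: compact_image_closed.
exists (\bigcup_n compact_image (b n)); first exact: bigcupT_measurable.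
exists (A `\` \bigcup_n compact_image (b n)); last first.
  rewrite setDUK // => x [n _]; exact: compact_image_sub.
have mBK n : measurable (B n `\` compact_image (b n) : set (borel Zomega)).
  by apply: measurableD => //; have [] := BP n.
exists (\bigcap_n (B n `\` compact_image (b n))); split.
- exact: bigcapT_measurable.
- apply/eqP; rewrite eq_le measure_ge0 andbT; apply/lee_addgt0Pr => e e0.
  rewrite add0e; have [n _ /(_ n (leqnn _))] := near_infty_natSinv_lt (PosNum (divr_gt0 e0 (ltr0Sn _ 1))).
  rewrite /= => ne; have [mB AB le] := BP n.
  apply: (@le_trans _ _ (mu (B n `\` compact_image (b n)))).
    apply: le_measure; rewrite ?inE //; first exact: bigcapT_measurable.
    by move=> x; exact.
  have KB : compact_image (b n) `<=` B n.
    by apply: subset_trans AB; exact: compact_image_sub.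
  rewrite measureD ?ltey_eq ?fin_num_measure // (setIidr KB).
  apply: (@le_trans _ _ ((sup D + n.+1%:R^-1)%:E - (sup D - n.+1%:R^-1)%:E)%E).
    exact: leeB.
  have lin (s q t : R) : q < t / 2 -> s + q - (s - q) <= t by move=> ?; lra.
  by rewrite -EFinB lee_fin; exact: lin ne.
- move=> x [Ax nK] n _; split; first by have [_ AB _] := BP n; exact: AB.
  by move=> Kx; apply: nK; exists n.
Qed.

End CompactImages.

(** * Averages over boxes *)

Fixpoint box (M : nat -> nat) (N : nat) : seq Zomega :=
  if N is N'.+1 then
    [seq (upd u N' k%:Z : Zomega) | u <- box M N', k <- index_iota 0 (M N')]
  else [:: (fun=> 0) : Zomega].

Lemma box_coord M N (u : Zomega) i : u \in box M N -> (i < N)%N ->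
  exists2 k : nat, (k < M i)%N & u i = k%:Z.
Proof.
elim: N u => [//|N IH] u /= /allpairsP[[v k] /= [vB kM ->]].
rewrite ltnS leq_eqVlt /upd => /predU1P[->|iN].
  by rewrite eqxx; exists k => //; rewrite mem_index_iota in kM.
by rewrite (ltn_eqF iN); exact: IH.
Qed.

Lemma box_repr M N (x : Zomega) :
  (forall i, (i < N)%N -> exists2 k : nat, (k < M i)%N & x i = k%:Z) ->
  exists2 u : Zomega, u \in box M N & agree N u x.
Proof.
elim: N => [|N IH] xM; first by exists (fun=> 0) => //; rewrite mem_seq1.
have [|u uB ux] := IH; first by move=> i iN; apply: xM; exact: leqW.
have [k kM xk] := xM N (leqnn _).
exists (upd u N k%:Z : Zomega).
  by apply/allpairsP; exists (u, k); rewrite mem_index_iota.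
by rewrite -xk; exact: (@agree_updS int).
Qed.

Lemma box_agree M M' N : agree N M M' -> box M N = box M' N.
Proof.
elim: N => [//|N IH] MM' /=; rewrite -IH; last exact: agree_le MM'.
by rewrite (MM' N).
Qed.

Section Average.
Context {R : realType}.
Implicit Types (F G : Zomega -> R) (M : nat -> nat).

Definition avg M N F : R := (\sum_(u <- box M N) F u) / (\prod_(i < N) M i)%:R.

Lemma avgS M N F : avg M N.+1 F =
  avg M N (fun u => (\sum_(0 <= k < M N) F (upd u N k%:Z)) / (M N)%:R).
Proof.
rewrite /avg /= big_allpairs_dep big_ord_recr /= natrM invfM.
by rewrite -mulr_suml mulrAC mulrA.
Qed.

Lemma avg_agree M M' N F : agree N M M' -> avg M N F = avg M' N F.
Proof.
move=> MM'; rewrite /avg (box_agree MM'); congr (_ / _%:R).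
by apply: eq_bigr => i _; exact: MM'.
Qed.

Lemma avg_le M N F G : (forall u, F u <= G u) -> avg M N F <= avg M N G.
Proof. by move=> FG; rewrite ler_wpM2r ?invr_ge0 ?ler0n// ler_sum. Qed.

Lemma avgB M N F G : avg M N (fun u => F u - G u) = avg M N F - avg M N G.
Proof. by rewrite /avg sumrB mulrBl. Qed.

Lemma avg_sum M N (I : Type) (r : seq I) (P : pred I) (G : I -> Zomega -> R) :
  avg M N (fun u => \sum_(i <- r | P i) G i u) = \sum_(i <- r | P i) avg M N (G i).
Proof. by rewrite /avg exchange_big mulr_suml. Qed.

Lemma avg_cst M N c : (forall i, (0 < M i)%N) -> avg M N (fun=> c) = c.
Proof.
move=> M0; elim: N => [|n IH]; first by rewrite /avg big_seq1 big_ord0 divr1.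
rewrite avgS -[RHS]IH; congr avg; apply/funext => u.
by rewrite sumr_const_nat subn0 -[c *+ _]mulr_natr mulfK // pnatr_eq0 -lt0n.
Qed.

Lemma avg_coord M N j (q : int -> R) : (forall i, (0 < M i)%N) -> (j < N)%N ->
  avg M N (fun u => q (u j)) = (\sum_(0 <= k < M j) q k%:Z) / (M j)%:R.
Proof.
move=> M0; have Mn i : (M i)%:R != 0 :> R by rewrite pnatr_eq0 -lt0n.
elim: N => [//|N IH]; rewrite ltnS leq_eqVlt avgS => /predU1P[->|jN].
  rewrite -[RHS](avg_cst N _ M0); congr avg; apply/funext => u.
  by congr (_ / _); apply: eq_bigr => k _; rewrite updE.
rewrite -(IH jN); congr avg; apply/funext => u; rewrite /upd (ltn_eqF jN).
by rewrite sumr_const_nat subn0 -[q _ *+ _]mulr_natr mulfK.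
Qed.

(** Translating an interval by [v] exchanges [`|v|] of its points. *)
Lemma sum_shift (a : int -> R) (m : nat) (v : int) :
  (forall k, 0 <= a k <= 1) ->
  \sum_(0 <= k < m) a k%:Z - `|v|%N%:R <= \sum_(0 <= k < m) a (k%:Z + v).
Proof.
have stepE (b : int -> R) :
    \sum_(0 <= k < m) b (k%:Z + 1) = \sum_(0 <= k < m) b k%:Z + b m%:Z - b 0.
  rewrite -(@big_nat_recr _ _ _ m 0%N (fun k => b k%:Z)) //= big_nat_recl //.
  by rewrite addrAC subrr add0r; apply: eq_bigr => k _; rewrite -addn1 PoszD.
have up (b : int -> R) : (forall k, 0 <= b k <= 1) ->
    \sum_(0 <= k < m) b k%:Z - 1 <= \sum_(0 <= k < m) b (k%:Z + 1).
  by move=> b01; rewrite stepE; have := b01 m%:Z; have := b01 0; lra.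
have down (b : int -> R) : (forall k, 0 <= b k <= 1) ->
    \sum_(0 <= k < m) b k%:Z - 1 <= \sum_(0 <= k < m) b (k%:Z - 1).
  move=> b01; have := stepE (fun k => b (k - 1)).
  under eq_bigr do rewrite addrK.
  by move=> ->; have := b01 (m%:Z - 1); have := b01 (0 - 1); lra.
move=> a01; elim/int_rect: v => [|n IH|n IH].
- by rewrite subr0; under [leRHS]eq_bigr do rewrite addr0.
- have := up (fun k => a (k + n%:Z)) (fun k => a01 _).
  have -> : \sum_(0 <= k < m) a (k%:Z + 1 + n%:Z) = \sum_(0 <= k < m) a (k%:Z + n.+1%:Z).
    by apply: eq_bigr => k _; congr a; lia.
  by move: IH; rewrite !absz_nat -natr1; lra.
- have := down (fun k => a (k - n%:Z)) (fun k => a01 _).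
  have -> : \sum_(0 <= k < m) a (k%:Z - 1 - n%:Z) = \sum_(0 <= k < m) a (k%:Z - n.+1%:Z).
    by apply: eq_bigr => k _; congr a; lia.
  by move: IH; rewrite !abszN !absz_nat -natr1; lra.
Qed.

(** Translating a box by [v] loses at most the proportion [`|v i| / M i] in the
coordinate [i]; the losses add up. *)
Lemma avg_shift M N F (v : Zomega) : (forall i, (0 < M i)%N) ->
  (forall u, 0 <= F u <= 1) ->
  (forall u w : Zomega, agree N u w -> F u = F w) ->
  avg M N F - \sum_(i < N) `|v i|%N%:R / (M i)%:R <= avg M N (fun u => F (u + v)).
Proof.
move=> M0; have Mn i : 0 < (M i)%:R :> R by rewrite ltr0n.
elim: N F => [|N IH] F F01 Fcyl.
  rewrite big_ord0 subr0 le_eqVlt; apply/orP; left; apply/eqP; congr avg.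
  by apply/funext => u; apply: Fcyl.
pose G (u : Zomega) := (\sum_(0 <= k < M N) F (upd u N k%:Z)) / (M N)%:R.
have {}IH := IH G.
rewrite !avgS big_ord_recr /= opprD addrA.
apply: (@le_trans _ _ (avg M N (fun u => G (u + v) - `|v N|%N%:R / (M N)%:R))).
  rewrite avgB avg_cst // lerB // IH // => [u|u w uw].
    apply/andP; split.
      by rewrite divr_ge0 ?(ltW (Mn _)) // sumr_ge0 // => k _; case/andP: (F01 (upd u N k%:Z)).
    rewrite ler_pdivrMr // mul1r; apply: (@le_trans _ _ (\sum_(0 <= k < M N) 1)).
      by apply: ler_sum => k _; case/andP: (F01 (upd u N k%:Z)).
    by rewrite sumr_const_nat subn0.
  congr (_ / _); apply: eq_bigr => k _; apply: Fcyl => i.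
  by rewrite ltnS leq_eqVlt /upd => /predU1P[->|iN]; rewrite ?eqxx // (ltn_eqF iN) uw.
apply: avg_le => u; rewrite /G -mulrBl ler_wpM2r ?invr_ge0 ?(ltW (Mn _)) //.
have := @sum_shift (fun k => F (upd (u + v) N k)) (M N) (v N) (fun k => F01 _).
move=> /le_trans; apply; rewrite le_eqVlt; apply/orP; left; apply/eqP.
apply: eq_bigr => k _; congr F; apply/funext => i.
by rewrite !Zomega_addE /upd; case: eqP => [->|].
Qed.

End Average.

(** * Uniform measures on infinite boxes *)

Section Digits.
Context {d : measure_display} {T : measurableType d}.

Lemma preimage_cylindrical (g : T -> Zomega) N (S : set Zomega) :
  (forall j (k : int), measurable [set x | g x j = k]) ->
  cylindrical N S -> measurable (g @^-1` S).
Proof.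
move=> mg; elim: N S => [|N IH] S Scyl.
  have [[x Sx]|noS] := pselect (exists x, S x).
    rewrite (_ : _ @^-1` _ = setT) // -subTset => y _; exact: Scyl Sx.
  by rewrite (_ : _ @^-1` _ = set0) // -subset0 => y Sy; apply: noS; exists (g y).
rewrite (_ : _ @^-1` _ = \bigcup_(k : int) ([set x | g x N = k] `&`
    g @^-1` [set u : Zomega | S (upd u N k : Zomega)])).
  apply: countable_bigcupT_measurable => // k; apply: measurableI => //.
  apply: IH => u w uw; apply: Scyl => i; rewrite ltnS leq_eqVlt /upd => /predU1P[->|iN].
    by rewrite eqxx.
  by rewrite (ltn_eqF iN) uw.
have updK (u : Zomega) : (upd u N (u N) : Zomega) = u.
  by apply/funext => i; rewrite /upd; case: eqP => [->|].
rewrite eqEsubset; split=> [x Sx|x [k _ [/= <-]]]; last by rewrite updK.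
by exists (g x N) => //; split=> //=; rewrite updK.
Qed.

Lemma measurable_borel (g : T -> borel Zomega) :
  (forall j (k : int), measurable [set x | (g x : Zomega) j = k]) ->
  measurable_fun setT g.
Proof.
move=> mg; apply: (@measurability _ _ T (borel Zomega) setT g (@open Zomega)) => // _ [S oS <-].
rewrite setTI (_ : _ @^-1` _ = \bigcup_N g @^-1`
    [set x : Zomega | forall y : Zomega, agree N x y -> S y]).
  apply: bigcupT_measurable => N; apply: (preimage_cylindrical mg (N := N)).
  by move=> x y xy Sx z yz; apply: Sx; apply: agree_trans yz.
rewrite eqEsubset; split=> [x Sx|x [N _]]; last exact.
by move: oS; rewrite openE => /(_ _ Sx) /nbhs_Zomega[N NS]; exists N.
Qed.

End Digits.
Section UniformMeasure.
Context {R : realType}.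

Definition uniform01 : set (measurableTypeR R) -> \bar R :=
  mrestr (@lebesgue_measure R) (measurable_itv `[0, 1[).
HB.instance Definition _ := Measure.on uniform01.

Let uniform01_setT : uniform01 setT = 1%E.
Proof.
by rewrite /uniform01 /mrestr setTI lebesgue_measure_itv /= lte_fin ltr01 -EFinB subr0.
Qed.
HB.instance Definition _ := Measure_isProbability.Build _ _ _ uniform01 uniform01_setT.

Variable M : nat -> nat.
Hypothesis M_gt0 : forall i, (0 < M i)%N.

Let P n : R := (\prod_(i < n) M i)%:R.

Let P_gt0 n : 0 < P n.
Proof. by rewrite ltr0n prodn_gt0. Qed.

Let PS n : P n.+1 = P n * (M n)%:R.
Proof. by rewrite /P big_ord_recr natrM. Qed.

(** The expansion of [x] in the mixed radix [M].  It carries the uniform measure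
of the unit interval to the product of the uniform measures on [0, M i[. *)
Definition digits (x : R) : Zomega :=
  fun i => Num.floor (x * P i.+1) - (M i)%:Z * Num.floor (x * P i).

Let measurable_floor_eq (c : R) (l : int) : 0 < c ->
  measurable [set x : measurableTypeR R | Num.floor (x * c) = l].
Proof.
move=> c0; rewrite (_ : [set _ | _] = `[l%:~R / c, (l + 1)%:~R / c[%classic).
  exact: measurable_itv.
apply/seteqP; split=> x /=; rewrite in_itv /= ler_pdivrMr // ltr_pdivlMr //.
  by move=> <-; exact: floor_itv.
exact: floor_def.
Qed.

Lemma digits_measurable :
  measurable_fun setT (digits : measurableTypeR R -> borel Zomega).
Proof.
apply: measurable_borel => j k.
rewrite (_ : [set _ | _] = \bigcup_(l : int) ([set x | Num.floor (x * P j) = l] `&`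
    [set x | Num.floor (x * P j.+1) = k + (M j)%:Z * l])).
  by apply: countable_bigcupT_measurable => // l;
    apply: measurableI; exact: measurable_floor_eq.
apply/seteqP; split=> x /=.
  by move=> <-; exists (Num.floor (x * P j)) => //; split=> //=; rewrite /digits subrK.
by move=> [l _ [/= lE]]; rewrite /digits lE => ->; rewrite addrK.
Qed.

Let digits_range (x : R) i : exists2 k : nat, (k < M i)%N & digits x i = k%:Z.
Proof.
have /andP[lo hi] := floor_itv (x * P i).
set l := Num.floor (x * P i) in lo hi.
have Mi : 0 < (M i)%:R :> R by rewrite ltr0n.
have d0 : 0 <= digits x i.
  rewrite /digits -/l subr_ge0 floor_ge_int PS mulrA intrM mulrC.
  by rewrite ler_pM2r.
have dM : digits x i < M i.
  rewrite /digits -/l ltrBlDr floor_lt_int PS mulrA -[X in X + _]mulr1 -mulrDr.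
  by rewrite intrM mulrC ltr_pM2l // addrC.
case: (digits x i) d0 dM => [k|//] _ kM; exists k => //.
Qed.

(** Equal first digits force equal integer parts of [x * P N], so the points of a
cylinder lie in an interval of length [(P N)^-1]. *)
Let digits_cylinder N (u : Zomega) :
  (uniform01 [set x | agree N u (digits x)] <= (P N)^-1%:E)%E.
Proof.
rewrite /uniform01 /mrestr.
have [[x [/= ux x01]]|no] := pselect (exists x, ([set x | agree N u (digits x)] `&` `[0, 1[) x); last first.
  rewrite (_ : _ `&` _ = set0) ?measure0 ?lee_fin ?invr_ge0 ?(ltW (P_gt0 _)) //.
  by rewrite -subset0 => x xin; apply: no; exists x.
set l := Num.floor (x * P N).
have mcyl : measurable ([set x : measurableTypeR R | agree N u (digits x)] `&` `[0, 1[).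
  apply: measurableI => //; rewrite -[X in measurable X]setTI.
  apply: digits_measurable => //; apply: (@cylindrical_borel N [set y : Zomega | agree N u y]).
  by move=> y z yz uy; exact: agree_trans yz.
apply: (@le_trans _ _ (lebesgue_measure (`[l%:~R / P N, (l + 1)%:~R / P N[ : set R))).
  apply: le_measure; rewrite ?inE // => y [/= uy y01].
  have -> : l = Num.floor (y * P N).
    have flE j : (j <= N)%N -> Num.floor (x * P j) = Num.floor (y * P j).
      elim: j => [_|j IH jN].
        rewrite /P big_ord0 !mulr1; rewrite !in_itv /= in x01 y01.
        by rewrite (@floor_def _ x 0) ?(@floor_def _ y 0).
      have : digits x j = digits y j by rewrite -ux // uy.
      by rewrite /digits IH 1?ltnW // => /addIr.
    exact: flE.
  by rewrite /= in_itv /= ler_pdivrMr // ltr_pdivlMr // floor_itv.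
rewrite lebesgue_measure_itv /= lte_fin ltr_pM2r ?invr_gt0 // ltr_int ltzD1 lexx.
by rewrite -EFinB lee_fin -mulrBl -intrB addrAC subrr add0r mul1r.
Qed.

(** The law of [digits]: the [N] first coordinates lie in the box, and each of its
points has probability at most the inverse of their number. *)
Lemma box_measure : exists mu : probability (borel Zomega) R,
  forall N (S : set Zomega), cylindrical N S -> (mu S <= (avg M N \1_S)%:E)%E.
Proof.
pose X : {mfun measurableTypeR R >-> borel Zomega} := mfun_Sub (mem_set digits_measurable).
exists (distribution uniform01 X) => N S Scyl.
have mcyl (u : Zomega) : measurable [set x : measurableTypeR R | agree N u (digits x)].
  rewrite -[X in measurable X]setTI.
  apply: digits_measurable => //; apply: (@cylindrical_borel N [set y : Zomega | agree N u y]).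
  by move=> y z yz uy; exact: agree_trans yz.
rewrite /distribution /pushforward /=.
have cover (s : seq Zomega) (A : set (measurableTypeR R)) : measurable A ->
    (forall x, A x -> exists2 u, u \in s & agree N u (digits x) /\ S u) ->
    (uniform01 A <= (\sum_(u <- s) \1_S u * (P N)^-1)%:E)%E.
  elim: s A => [|u s IH] A mA As.
    rewrite big_nil (_ : A = set0) ?measure0 //.
    by rewrite -subset0 => x /As[u]; rewrite in_nil.
  have [Su|nSu] := pselect (S u); last first.
    rewrite big_cons indicE memNset // mul0r add0r; apply: IH => // x /As[w].
    by rewrite inE => /predU1P[->[]//|ws wx]; exists w.
  rewrite big_cons indicE mem_set // mul1r EFinD.
  set C := [set x | agree N u (digits x)].
  have mC : measurable C := mcyl u.
  have mI : measurable (A `&` C) by exact: measurableI.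
  have mD : measurable (A `\` C) by exact: measurableD.
  rewrite -(setUIDK A C); apply: le_trans (measureU2 _ mI mD) _.
  apply: leeD.
    apply: le_trans (digits_cylinder N u); by apply: le_measure; rewrite ?inE.
  apply: IH => //.
  by move=> x [/As[w]]; rewrite inE => /predU1P[->[]//|ws wx] _; exists w.
rewrite /avg mulr_suml; apply: cover.
  rewrite -[X in measurable X]setTI; apply: digits_measurable => //.
  exact: cylindrical_borel Scyl.
move=> x Sx; have [|u uB ux] := @box_repr M N (digits x); first by move=> i _.
by exists u => //; split=> //; apply: Scyl Sx; exact: agree_sym.
Qed.

End UniformMeasure.

(** * Witnesses that an analytic set meets large boxes *)

Section Captures.
Context {R : realType} (phi : {ptws nat -> nat} -> Zomega).
Hypothesis phi_cont : continuous phi.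

(** A witness packs three sequences into one: side lengths of a box, a translation
vector, and bounds on the arguments of [phi].  As a single sequence over a
countable type it can be produced by [uniformization]. *)
Definition side (w : nat -> nat * int * nat) : nat -> nat := fun i => (w i).1.1.
Definition offset (w : nat -> nat * int * nat) : Zomega := fun i => (w i).1.2.
Definition bound (w : nat -> nat * int * nat) : nat -> nat := fun i => (w i).2.

Definition captured (w : nat -> nat * int * nat) (N : nat) : set Zomega :=
  [set u | approx_image phi (bound w) N (u - offset w)].

(** The coordinates below [n] carry no growth condition: this is what allows a
single proportion [2^-n] to serve for all [c].  The factor [2 ^ (i + 4)] makes
the losses of a proportion [3 * c i / side w i] in the coordinates [i >= n] sum
to at most half of [2^-n]. *)
Definition captures (n : nat) (c : nat -> nat) (w : nat -> nat * int * nat) :=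
  (forall i, (0 < side w i)%N /\ ((n <= i)%N -> (2 ^ (i + 4) * c i <= side w i)%N)) /\
  forall N, 2^-1 ^+ n <= avg (side w) N \1_(captured w N) :> R.

Lemma captured_cylindrical w N : cylindrical N (captured w N).
Proof.
move=> x y xy; apply: approx_image_cylindrical => i iN; rewrite !Zomega_subE.
by rewrite xy.
Qed.

Lemma captured_agree w w' N : agree N w w' -> captured w N `<=` captured w' N.
Proof.
move=> ww' u /(@approx_image_agree _ _ (bound w') _ _) uw.
apply: approx_image_cylindrical (uw _) => i iN; last by rewrite /bound ww'.
by rewrite !Zomega_subE /offset ww'.
Qed.

Lemma captures_closed n c w :
  (forall N, exists c' w', [/\ agree N c c', agree N w w' & captures n c' w']) ->
  captures n c w.
Proof.
move=> cl; split=> [i|N].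
  have [c' [w' [cc' ww' [/(_ i)]]]] := cl i.+1.
  by rewrite /side cc' // ww'.
have [c' [w' [_ ww' [_ /(_ N)]]]] := cl N.
have -> : captured w N = captured w' N.
  by rewrite eqEsubset; split; apply: captured_agree => //; exact: agree_sym.
by rewrite (@avg_agree _ (side w') (side w)) // => i iN; rewrite /side ww'.
Qed.

Lemma captures_antitone n c c' w :
  (forall i, (c' i <= c i)%N) -> captures n c w -> captures n c' w.
Proof.
move=> c'c [sw aw]; split=> // i; have [s0 sc] := sw i; split=> // /sc.
by apply: leq_trans; rewrite leq_mul2l c'c orbT.
Qed.

(** If each proportion [2^-n] failed for some [c n], consider side lengths that
beat [c m] in all the coordinates [i >= m], for every [m].  Some translate of the
range is not null for the uniform measure on that box, hence contains a compact
set of measure at least some [r > 0]; this contradicts the choice of [c n] once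
[2^-n <= r]. *)
Lemma captures_total : ~ haar_null R (range phi) ->
  exists n, forall c, exists w, captures n c w.
Proof.
move=> nh; apply: contrapT => /forallNP no.
have /choice[c cP] : forall n, exists c, forall w, ~ captures n c w.
  by move=> n; apply: contrapT => /forallNP h; apply: (no n) => c; apply: contrapT => /forallNP; exact: h.
pose f i := (1 + 2 ^ (i + 4) * \max_(m < i.+1) c m i)%N.
have f0 i : (0 < f i)%N by [].
have [mu muP] := @box_measure R f f0.
have [g gP] : exists g : Zomega, ~ mu.-negligible [set u + g | u in range phi].
  apply: contrapT => /forallNP ng; apply: nh; exists (range phi); split=> //.
    exact: range_universally_measurable.
  by exists mu => g; apply: contrapT; exact: ng.
pose psi (y : {ptws nat -> nat}) : Zomega := phi y + g.
have [|r r0 thr] := @thick_not_negligible _ _ _ mu (range psi).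
  suff -> : range psi = [set u + g | u in range phi] by [].
  by rewrite image_comp.
have [b rb] := inner_regular thr.
have [n nr] : exists n, 2^-1 ^+ n <= r.
  have [n _ /(_ n (leqnn _))] := near_infty_natSinv_lt (PosNum r0).
  move=> /= /ltW nr; exists n; apply: le_trans nr.
  rewrite exprVn lef_pV2 ?posrE ?exprn_gt0 ?ltr0n //.
  by rewrite -natrX ler_nat ltn_expl.
pose w i := (f i, g i, b i).
apply: (cP n w); split=> [i|N].
  split=> // ni; rewrite /side /= /f add1n; apply: leqW; rewrite leq_mul2l.
  rewrite -ltnS in ni; apply/orP; right.
  exact: (@leq_bigmax _ (fun m : 'I_i.+1 => c m i) (Ordinal ni)).
apply: le_trans nr _; rewrite -lee_fin.
apply: le_trans (muP N _ (@captured_cylindrical w N)); apply: le_trans rb _.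
apply: le_measure; rewrite ?inE.
- by apply: closed_borel; exact: compact_image_closed.
- exact: cylindrical_borel (@captured_cylindrical w N).
move=> x /(_ N I) [_ [y yb <-] xy]; exists (phi y); first by exists y.
by move=> i iN; rewrite Zomega_subE xy // /psi Zomega_addE addrK.
Qed.

End Captures.

(** * Tightness and averaging *)

Section Measure.
Context {R : realType} (mu : probability (borel Zomega) R).
Local Open Scope ereal_scope.

Let int_of (k : nat) : int := odflt 0%R (unpickle k).

Let int_ofK (v : int) : int_of (pickle v) = v.
Proof. by rewrite /int_of pickleK. Qed.

Lemma positive_cylinder n : exists a : Zomega, 0 < mu [set v | agree n a v].
Proof.
elim: n => [|n [a a0]].
  by exists 0%R; rewrite (_ : [set _ | _] = setT) ?probability_setT ?lte_fin ?ltr01 //; apply/seteqP.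
apply: contrapT => /forallNP no.
pose F k : set (borel Zomega) := [set v : Zomega | agree n.+1 (upd a n (int_of k)) v].
have mF k : measurable (F k).
  by apply: (@cylindrical_borel n.+1) => x y xy ax; apply: agree_trans xy.
have : mu (\bigcup_k F k) = 0.
  apply: measure_negligible; first exact: bigcupT_measurable.
  apply: negligible_bigcup => k; apply/negligibleP => //.
  apply/eqP; rewrite eq_le measure_ge0 andbT leNgt; apply/negP.
  exact: (no (upd a n (int_of k))).
suff -> : \bigcup_k F k = [set v : Zomega | agree n a v] by move=> mu0; rewrite mu0 ltxx in a0.
apply/seteqP; split=> [v [k _ av]|v av].
  by apply: (@agree_trans _ _ _ (upd a n (int_of k))); [exact: agree_upd|exact: agree_le av].
by exists (pickle (v n)) => //; rewrite /F /= int_ofK; exact: agree_updS.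
Qed.

(** A set of positive measure whose points share their first [n] coordinates and
are bounded in the other ones.  Tightness is [inner_regular] for the map that
decodes natural numbers into integers, which ranges over the whole cylinder. *)
Lemma tight_cylinder n : exists a h (L : set Zomega) (r : R), [/\ (0 < r)%R,
  measurable (L : set (borel Zomega)), r%:E <= mu L &
  forall v, L v -> agree n a v /\ forall i, (n <= i)%N -> (`|v i| <= h i)%N].
Proof.
have [a a0] := positive_cylinder n.
pose phi (y : {ptws nat -> nat}) : Zomega :=
  fun i => if (i < n)%N then a i else int_of (y i).
have [|r r0 thr] := @thick_not_negligible _ _ _ mu (range phi).
  move=> [B [mB B0 AB]]; suff : mu [set v | agree n a v] <= mu B by rewrite B0 leNgt a0.
  apply: le_measure; rewrite ?inE //.
    by apply: (@cylindrical_borel n) => x y xy ax; apply: agree_trans xy.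
  move=> v av; apply: AB; exists (fun i => pickle (v i)) => //.
  by apply/funext => i; rewrite /phi; case: ifP => [/av//|_]; rewrite int_ofK.
have [b rb] := inner_regular thr.
exists a, (fun i => \max_(k < (b i).+1) `|int_of k|)%N, (compact_image phi b), r; split=> //.
  by apply: closed_borel; exact: compact_image_closed.
move=> v Kv; split=> [i ni|i ni].
  by have [_ [y _ <-] vy] := Kv n I; rewrite vy // /phi ni.
have [_ [y yb <-] vy] := Kv i.+1 I.
have yi : (y i < (b i).+1)%N by rewrite ltnS yb.
rewrite vy // /phi ltnNge ni /=.
exact: (@leq_bigmax _ (fun k : 'I_(b i).+1 => `|int_of k|%N) (Ordinal yi)).
Qed.

(** Fubini's theorem for a finite family of sets: points of [L] lying in many of
the [F u] make the [F u] large on average. *)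
Lemma average_measure (I : Type) (s : seq I) (F : I -> set (borel Zomega))
    (L : set (borel Zomega)) (c : R) :
  (0 <= c)%R -> measurable L -> (forall u, measurable (F u)) ->
  (forall v, L v -> (c <= \sum_(u <- s) \1_(F u) v)%R) ->
  c%:E * mu L <= \sum_(u <- s) mu (L `&` F u).
Proof.
move=> c0 mL mF cF.
rewrite -integral_cst //.
rewrite (eq_bigr (fun u => \int[mu]_(v in L) (\1_(F u) v)%:E)); last first.
  by move=> u _; rewrite integral_indic // setIC.
have m1 u : measurable_fun L (fun v => (\1_(F u) v)%:E : \bar R).
  by apply/measurable_EFinP; apply: measurable_indic.
have ind0 u v : L v -> 0 <= (\1_(F u) v)%:E :> \bar R by move=> _; rewrite lee_fin.
rewrite -(ge0_integral_sum mu mL m1 ind0).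
apply: ge0_le_integral => //.
  exact: emeasurable_sum.
by move=> v Lv; rewrite sumEFin lee_fin; exact: cF.
Qed.

End Measure.

(** * The closed subset *)

Section ClosedSet.
Variable phi : {ptws nat -> nat} -> Zomega.
Variable Phi : (nat -> nat) -> nat -> nat * int * nat.

Definition spread_image : set Zomega := [set x | exists c : nat -> nat,
  compact_image phi (bound (Phi c)) x /\ forall i, (c i <= `|x i|)%N].

(** Near a limit point [x], the growth rates [c] in use are bounded by [x] on
longer and longer segments; by compactness they accumulate at some [c], and
[Phi] is continuous there. *)
Lemma spread_image_closed :
  (forall c N, exists M, forall c', agree M c c' -> agree N (Phi c) (Phi c')) ->
  closed spread_image.
Proof.
move=> Phi_cont; apply: closed_agree => x xcl.
pose P N c := exists c' (x' : Zomega), [/\ agree N c c', agree N x x',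
  compact_image phi (bound (Phi c')) x' & forall i, (c' i <= `|x' i|)%N].
have [|||c cx cP] := @konig (fun i => `|x i|%N) P.
- move=> N c d cd [c' [x' [cc' xx' Kx' c'x']]]; exists c', x'; split=> //.
  by apply: agree_trans cc'; exact: agree_sym.
- move=> N c [c' [x' [cc' xx' Kx' c'x']]]; exists c', x'; split=> //.
    exact: agree_le cc'.
  exact: agree_le xx'.
- move=> N; have [x' xx' [c' [Kx' c'x']]] := xcl N.
  exists (fun i => if (i < N)%N then c' i else 0%N).
    by move=> i; case: ifP => // iN; rewrite xx'.
  by exists c', x'; split=> // i iN; rewrite iN.
exists c; split=> // m _; have [M Mc] := Phi_cont c m.
have [c' [x' [cc' xx' Kx' _]]] := cP (maxn M m).
apply: (@approx_image_cylindrical _ _ _ x').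
  by apply/agree_sym/(agree_le _ xx'); rewrite leq_maxr.
apply: approx_image_agree (Kx' m I) => i im; rewrite /bound (Mc c') //.
by apply: agree_le cc'; rewrite leq_maxl.
Qed.

End ClosedSet.

(** * The closed subset is not Haar null *)

Section Counting.
Context {R : realType}.

Lemma sum_near_le (m c : nat) (t : int) :
  \sum_(0 <= k < m) (absz (k%:Z + t)%R < c)%N%:R <= (2 * c)%:R :> R.
Proof.
have point (z : int) : \sum_(0 <= k < m) (k%:Z == z :> int)%R%:R <= 1 :> R.
  suff -> : \sum_(0 <= k < m) (k%:Z == z :> int)%R%:R = (0 <= z < m%:Z)%R%:R :> R.
    by rewrite lern1 leq_b1.
  elim: m => [|k IH]; first by rewrite big_nil; case: z => z //; case: leP.
  rewrite big_nat_recr //= IH -natrD; congr _%:R; lia.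
have interval (a : int) l :
    \sum_(0 <= k < m) ((a <= k%:Z + t) && (k%:Z + t < a + l%:Z))%R%:R <= l%:R :> R.
  elim: l => [|l IH].
    by rewrite big1 // => k _; rewrite addr0; case: leP => //= h; rewrite ltNge h.
  rewrite -natr1; apply: le_trans (lerD IH (point (a + l%:Z - t))).
  rewrite -big_split; apply: ler_sum => k _ /=; rewrite -natrD ler_nat; lia.
apply: le_trans (interval (- c%:Z) (2 * c)%N); apply: ler_sum => k _.
rewrite ler_nat; lia.
Qed.

Lemma sum_loss_le (n N : nat) (e : nat -> R) :
  (forall i, (i < n)%N -> e i = 0) ->
  (forall i, (n <= i)%N -> 0 <= e i <= 3 / 2 ^+ (i + 4)) ->
  \sum_(i < N) e i <= 2^-1 * 2^-1 ^+ n.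
Proof.
move=> e0 e1.
have e_ge0 i : 0 <= e i.
  by have [ni|ni] := ltnP i n; [rewrite e0|case/andP: (e1 i ni)].
have tail k : \sum_(i < n + k) e i <= 3 / 8 * 2^-1 ^+ n * (1 - 2^-1 ^+ k).
  elim: k => [|k IH].
    by rewrite addn0 expr0 subrr mulr0 big1 // => i _; exact: e0.
  rewrite addnS big_ord_recr /=.
  have /andP[_] := e1 (n + k)%N (leq_addr _ _).
  move: IH; rewrite !exprVn (exprS _ k) !exprD !invfM.
  set x := 2 ^- n; set y := 2 ^- k; lra.
apply: (@le_trans _ _ (\sum_(i < n + N) e i)).
  rewrite addnC big_split_ord /= lerDl sumr_ge0 //.
apply: le_trans (tail N) _.
have x0 : 0 <= 2^-1 ^+ n :> R by rewrite exprn_ge0 // invr_ge0.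
have y0 : 0 <= 2^-1 ^+ N :> R by rewrite exprn_ge0 // invr_ge0.
nra.
Qed.

End Counting.

Section Catching.
Context {R : realType}.
Variable phi : {ptws nat -> nat} -> Zomega.

(** The box points [x] whose translate back looks, on the first [N] coordinates,
like a point of the closed subset. *)
Definition spread_captured w (c : nat -> nat) (N : nat) : set Zomega :=
  [set x | captured phi w N x /\
    forall i, (i < N)%N -> (c i <= absz ((x - offset w : Zomega)%R i))%N].

Lemma spread_captured_cylindrical w c N : cylindrical N (spread_captured w c N).
Proof.
move=> x y xy [Ex xc]; split; first exact: captured_cylindrical Ex.
by move=> i iN; rewrite Zomega_subE -xy // xc.
Qed.

Lemma spread_capturedS w c N : spread_captured w c N.+1 `<=` spread_captured w c N.
Proof.
move=> x [Ex xc]; split; first exact: approx_imageS Ex.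
by move=> i iN; apply: xc; exact: leqW.
Qed.

(** Starting from the proportion [2^-n] given by the witness, translating by [v]
costs at most [c i / side w i] in the coordinate [i], and discarding the points
with a coordinate [i] of absolute value less than [c i] costs at most
[2 * c i / side w i]. *)
Lemma avg_spread_captured n c w (v : Zomega) N : captures phi (R := R) n c w ->
  (forall i, (i < n)%N -> c i = 0%N) -> (forall i, (absz (v i) <= c i)%N) ->
  2^-1 * 2^-1 ^+ n <= avg (side w) N (fun u => \1_(spread_captured w c N) (u + v)) :> R.
Proof.
move=> [sw aw] c0 vc.
have M0 i : (0 < side w i)%N by have [] := sw i.
have Mn i : 0 < (side w i)%:R :> R by rewrite ltr0n.
pose q i (z : int) : R := (absz (z + (v i - offset w i : int))%R < c i)%N%:R.
pose e i : R := (`|v i|%N%:R + (2 * c i)%:R) / (side w i)%:R.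
have loss : \sum_(i < N) e i <= 2^-1 * 2^-1 ^+ n.
  apply: (sum_loss_le (n := n)) => i ni; rewrite /e.
    by have := vc i; rewrite c0 // leqn0 => /eqP ->; rewrite muln0 addr0 mul0r.
  apply/andP; split; first by rewrite divr_ge0.
  have [_ /(_ ni) ci] := sw i.
  rewrite ler_pdivrMr // mulrAC ler_pdivlMr ?exprn_gt0 // -natrX -natrD -!natrM ler_nat.
  have := vc i; nia.
have E01 u : 0 <= (\1_(captured phi w N) u : R) <= 1.
  by rewrite indicE; case: (_ \in _); rewrite ?lexx ?ler01.
have Ecyl (u u' : Zomega) : agree N u u' -> \1_(captured phi w N) u = \1_(captured phi w N) u' :> R.
  move=> uu'; rewrite !indicE; congr _%:R; congr nat_of_bool.
  apply/idP/idP; rewrite !inE; apply: captured_cylindrical => //; exact: agree_sym.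
have sh := avg_shift v M0 E01 Ecyl.
have rem i : (i < N)%N -> avg (side w) N (fun u => q i (u i)) <= (2 * c i)%:R / (side w i)%:R.
  by move=> iN; rewrite avg_coord // ler_wpM2r ?invr_ge0 // sum_near_le.
apply: (@le_trans _ _ (avg (side w) N (fun u => \1_(captured phi w N) (u + v) -
    \sum_(i < N) q i (u i)))).
  rewrite avgB (avg_sum _ _ _ _ (fun (i : 'I_N) u => q i (u i))).
  have sumrem : \sum_(i < N) avg (side w) N (fun u => q i (u i)) <=
      \sum_(i < N) (2 * c i)%:R / (side w i)%:R.
    by apply: ler_sum => i _; exact: rem.
  have eE : \sum_(i < N) e i = \sum_(i < N) `|v i|%N%:R / (side w i)%:R +
      \sum_(i < N) (2 * c i)%:R / (side w i)%:R.
    by rewrite -big_split; apply: eq_bigr => i _; rewrite /e mulrDl.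
  have := aw N; move: sh sumrem loss; rewrite eE; lra.
apply: avg_le => u; rewrite lerBlDr.
have q0 (i : 'I_N) : 0 <= q i (u i) by rewrite ler0n.
have s0 : 0 <= \sum_(i < N) q i (u i) by exact: sumr_ge0.
have [Euv|nE] := pselect (captured phi w N (u + v)); last first.
  by rewrite [leLHS]indicE memNset // addr_ge0.
have [far|] := pselect (forall i, (i < N)%N -> (c i <= absz ((u + v - offset w : Zomega)%R i))%N).
  by rewrite !indicE !mem_set ?lerDl.
move=> /existsNP[i /not_implyP[iN /negP]]; rewrite -ltnNge => near.
rewrite [leLHS]indicE mem_set //; apply: (@le_trans _ _ (q i (u i))).
  rewrite /q addrA; move: near; rewrite Zomega_subE Zomega_addE => near.
  by rewrite ler1n lt0b.
rewrite (bigD1 (Ordinal iN)) //= addrCA lerDl addr_ge0 // sumr_ge0 //.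
Qed.

(** Given a probability [mu], take [c] to bound a set [L] of positive measure as in
[tight_cylinder].  By averaging, for each [N] some point [u] of the box has
translates by many points of [L] in [spread_captured w c N]; compactness of the
box gives a point [u] that serves all [N], and this is a translate of the closed
subset of positive measure. *)
Lemma spread_image_not_null n Phi : (forall c, captures (R := R) phi n c (Phi c)) ->
  ~ haar_null R (spread_image phi Phi).
Proof.
move=> cap [U [_ CU [mu muU]]].
have [a [h [L [r [r0 mL rL LP]]]]] := tight_cylinder mu n.
pose c i := if (i < n)%N then 0%N else h i.
pose w := Phi c; pose M := side w.
have M0 i : (0 < M i)%N by have [/(_ i)[]] := cap c.
(* The points of L agree on the coordinates below n, where the box need not be
   large: only the other coordinates are used for translating, and the common
   values go into the final translation z. *)
pose rest (v : Zomega) : Zomega := fun i => if (i < n)%N then 0 else v i.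
pose F N (u : Zomega) : set (borel Zomega) := [set v | spread_captured w c N (u + rest v)].
have mF N u : measurable (F N u).
  apply: (@cylindrical_borel N) => v v' vv'; apply: spread_captured_cylindrical => i iN.
  by rewrite !Zomega_addE /rest vv'.
pose eta : R := 2^-1 * 2^-1 ^+ n.
have eta0 : 0 < eta by rewrite mulr_gt0 ?exprn_gt0 // invr_gt0.
pose delta := eta * r / 2.
have delta0 : 0 < delta by rewrite /delta divr_gt0 // mulr_gt0.
have catch N : exists2 u, u \in box M N & (delta%:E <= mu (L `&` F N u))%E.
  apply: contrapT => no.
  pose p : R := (\prod_(i < N) M i)%:R.
  have p0 : 0 < p by rewrite ltr0n prodn_gt0.
  have : ((eta * p)%:E * mu L <= \sum_(u <- box M N) mu (L `&` F N u))%E.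
    apply: average_measure => //; first by rewrite mulr_ge0 // ltW.
    move=> v Lv; rewrite -ler_pdivlMr //.
    have vc i : (absz (rest v i) <= c i)%N.
      by rewrite /rest /c; case: ltnP => // ni; have [_] := LP v Lv; exact.
    have c0 i : (i < n)%N -> c i = 0%N by rewrite /c => ->.
    apply: le_trans (avg_spread_captured N (cap c) c0 vc) _.
    by rewrite /avg -/w -/M -/p ler_wpM2r ?invr_ge0 ?(ltW p0).
  apply/negP; rewrite -ltNge.
  apply: (@le_lt_trans _ _ (\sum_(u <- box M N) delta%:E)%E).
    rewrite big_seq [leRHS]big_seq; apply: lee_sum => u uB.
    by rewrite leNgt; apply/negP => /ltW lt; apply: no; exists u.
  have sumE : \sum_(u <- box M N) delta = p * delta.
    have := avg_cst N delta M0; rewrite /avg -/p => /(congr1 (fun x => p * x)) <-.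
    by rewrite mulrC divfK // gt_eqF.
  rewrite sumEFin sumE; apply: (@lt_le_trans _ _ ((eta * p)%:E * r%:E)%E).
    rewrite -EFinM lte_fin /delta.
    have : 0 < p * (eta * r) by rewrite mulr_gt0 // mulr_gt0.
    by rewrite -mulrA; nra.
  by rewrite lee_pmul2l // lte_fin mulr_gt0.
pose nat_point (y : nat -> nat) : Zomega := fun i => (y i)%:Z.
have [|||y _ yP] := @konig M (fun N y => (delta%:E <= mu (L `&` F N (nat_point y)))%E).
- move=> N y z yz; suff -> : F N (nat_point y) = F N (nat_point z) by [].
  have uv (v : Zomega) : agree N (nat_point y + rest v : Zomega) (nat_point z + rest v : Zomega).
    by move=> i iN; rewrite !Zomega_addE /nat_point yz.
  apply/seteqP; split=> v; apply: spread_captured_cylindrical => //; exact: agree_sym.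
- move=> N y /le_trans; apply; apply: le_measure; rewrite ?inE; try exact: measurableI.
  by apply: setIS => v; exact: spread_capturedS.
- move=> N; have [u uB ud] := catch N.
  exists (fun i => if (i < N)%N then absz (u i) else 0%N).
    by move=> i; case: ifP => // iN; have [k kM ->] := box_coord uB iN; exact: ltnW.
  apply: le_trans ud _; apply: le_measure; rewrite ?inE; try exact: measurableI.
  apply: setIS => v; apply: spread_captured_cylindrical => i iN; rewrite !Zomega_addE /nat_point iN.
  by have [k _ ->] := box_coord uB iN.
pose u := nat_point y.
have big : (delta%:E <= mu (\bigcap_N (L `&` F N u)))%E.
  apply: nonincreasing_measure_ge => N; first exact: measurableI.
    by apply: setIS => v; exact: spread_capturedS.
  exact: yP.
pose z : Zomega := fun i => offset w i - u i + (if (i < n)%N then a i : int else 0).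
have [B [mB B0 UB]] := muU z.
suff : (mu (\bigcap_N (L `&` F N u)) <= mu B)%E.
  by rewrite B0 => /(le_trans big); rewrite lee_fin leNgt delta0.
apply: le_measure; rewrite ?inE //.
  by apply: bigcapT_measurable => N; exact: measurableI.
move=> v vX; apply: UB; exists (u + rest v - offset w); last first.
  have [Lv _] := vX 0%N I; have [av _] := LP v Lv.
  apply/funext => i; rewrite Zomega_addE Zomega_subE Zomega_addE /z /rest.
  by case: ifP => [/av <-|_]; ring.
apply: CU; exists c; split=> [m _|i].
  by have [_ []] := vX m I.
by have [_ [_]] := vX i.+1 I; exact.
Qed.

End Catching.

Theorem theorem0p2 (R : realType) (A : set Zomega) :
  analytic_set A -> ~ haar_null R A ->
  exists C : set Zomega, [/\ closed C, C `<=` A & ~ haar_null R C].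
Proof.
move=> [-> nh|[phi phi_cont <-] nh]; first by exists set0; split=> //; exact: closed0.
have [n total] := captures_total phi_cont nh.
have [Phi [cap Phi_cont]] := uniformization (0%N, 0, 0%N)
  (@captures_closed R phi n) (@captures_antitone R phi n) total.
exists (spread_image phi Phi); split.
- exact: spread_image_closed.
- by move=> x [c [Kx _]]; exact: compact_image_sub Kx.
- exact: spread_image_not_null cap.
Qed.
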